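(* Let $p\ge 1$ be an integer and, for integers $n\ge 0$, let $$S_n^p=\frac{(-1)^n}{n!}\sum_{k=0}^{n}\frac{(-1)^{k}\binom{n}{k}}{(k+1)^p}.$$ Then for every $t\in\mathbb{R}$, $$e^{-t}\,{}_{p}F_{p}\left[1,\dots,1;2,\dots,2;t\right]=\sum_{n=0}^{\infty}S_n^p\,t^{n},$$ where the hypergeometric function has $p$ upper parameters all equal to $1$ and $p$ lower parameters all equal to $2$.
   Context: The generalized hypergeometric function is ${}_{p}F_{q}\left[a_{1},\dots,a_{p};b_{1},\dots,b_{q};z\right]=\sum_{k=0}^{\infty}\frac{\prod_{m=1}^{p}(a_{m})_{k}}{\prod_{m=1}^{q}(b_{m})_{k}}\frac{z^{k}}{k!}$, where $(c)_0=1$ and $(c)_n=c(c+1)\cdots(c+n-1)$ for $n\ge1$. The numbers $S_n^p$ are called generalized Stirling numbers of the second kind. *)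

(* Defs.v *)
(* Stdlib reals and Coquelicot. *)
From Stdlib Require Import Reals Factorial List.
From Coquelicot Require Import Coquelicot.
Open Scope R_scope.

Fixpoint pochhammer (c : R) (n : nat) : R :=
  match n with
  | O => 1
  | S m => pochhammer c m * (c + INR m)
  end.

Definition pochhammer_prod (l : list R) (k : nat) : R :=
  fold_right Rmult 1 (map (fun c => pochhammer c k) l).

Definition hypergeometric_term (a b : list R) (z : R) (k : nat) : R :=
  pochhammer_prod a k / pochhammer_prod b k * (z ^ k / INR (fact k)).

(* pFq[a; b; z], with p and q the lengths of [a] and [b].  [Series] is total, so
   this is meaningful only where the series converges and no lower parameter
   is a nonpositive integer. *)
Definition hypergeometric (a b : list R) (z : R) : R :=
  Series (hypergeometric_term a b z).

(* The generalized Stirling number S_n^p.  [Binomial.C] is qualified because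
   Coquelicot uses [C] for the complex numbers. *)
Definition gen_stirling2 (p n : nat) : R :=
  (-1) ^ n / INR (fact n) *
  sum_f_R0 (fun k => (-1) ^ k * Binomial.C n k / (INR k + 1) ^ p) n.

(* Main.v *)
(* Multiplying the series of [exp (- t)] by that of the hypergeometric function,
   whose [k]-th term is [t ^ k / (k! (k + 1) ^ p)], the Cauchy product has [n]-th
   coefficient [S_n^p], since [(-1) ^ (n - k) = (-1) ^ n (-1) ^ k] and
   [n! / (k! (n - k)!)] is a binomial coefficient. *)
Require Import Defs.
From Stdlib Require Import Reals Factorial List.
From Coquelicot Require Import Coquelicot.
From Stdlib Require Import Lra Lia.
Open Scope R_scope.

Lemma pochhammer_1 (k : nat) : pochhammer 1 k = INR (fact k).
Proof.
  induction k as [|k IH]; [reflexivity|].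
  cbn [pochhammer]; rewrite IH, fact_simpl, mult_INR, S_INR; ring.
Qed.

Lemma pochhammer_2 (k : nat) : pochhammer 2 k = INR (fact (S k)).
Proof.
  induction k as [|k IH]; [reflexivity|].
  cbn [pochhammer]; rewrite IH, (fact_simpl (S k)), mult_INR, !S_INR; ring.
Qed.

Lemma pochhammer_prod_repeat (c : R) (p k : nat) :
  pochhammer_prod (repeat c p) k = pochhammer c k ^ p.
Proof.
  unfold pochhammer_prod; induction p as [|p IH]; [reflexivity|].
  simpl; rewrite IH; reflexivity.
Qed.

(** Each upper parameter contributes [k!] and each lower one [(k + 1)!], so each of the [p] pairs
    leaves the quotient [/ (k + 1)]. *)
Lemma hypergeometric_term_repeat_1_2 (p : nat) (t : R) (k : nat) :
  hypergeometric_term (repeat 1 p) (repeat 2 p) t k =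
  / (INR k + 1) ^ p * (t ^ k / INR (fact k)).
Proof.
  unfold hypergeometric_term.
  rewrite !pochhammer_prod_repeat, pochhammer_1, pochhammer_2.
  rewrite fact_simpl, mult_INR, S_INR, Rpow_mult_distr.
  pose proof (INR_fact_neq_0 k) as Hf.
  pose proof (pos_INR k) as Hk.
  field; repeat split; try apply pow_nonzero; try assumption; lra.
Qed.

Lemma is_series_exp (x : R) : is_series (fun k => x ^ k / INR (fact k)) (exp x).
Proof.
  (* This is the unfolded form of the power series in [is_exp_Reals]. *)
  apply (is_series_ext (fun k => scal (pow_n x k) (/ INR (fact k)))).
  - intros k; rewrite pow_n_pow; reflexivity.
  - exact (is_exp_Reals x).
Qed.

Lemma Rabs_exp_term (x : R) (k : nat) :
  Rabs (x ^ k / INR (fact k)) = Rabs x ^ k / INR (fact k).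
Proof.
  unfold Rdiv; rewrite Rabs_mult, <- RPow_abs, Rabs_inv.
  rewrite (Rabs_pos_eq (INR _)); [reflexivity | apply pos_INR].
Qed.

Lemma ex_series_Rabs_exp (x : R) :
  ex_series (fun k => Rabs (x ^ k / INR (fact k))).
Proof.
  exists (exp (Rabs x)).
  apply (is_series_ext (fun k => Rabs x ^ k / INR (fact k))).
  - intros k; symmetry; apply Rabs_exp_term.
  - apply is_series_exp.
Qed.

(** Since [(k + 1) ^ p >= 1], the exponential series at [Rabs t] dominates. Absolute convergence is
    what the Cauchy product asks for. *)
Lemma ex_series_Rabs_hypergeometric_1_2 (p : nat) (t : R) :
  ex_series (fun k => Rabs (hypergeometric_term (repeat 1 p) (repeat 2 p) t k)).
Proof.
  apply (ex_series_le (K := R_AbsRing) (V := R_CompleteNormedModule) _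
           (fun k => Rabs (t ^ k / INR (fact k)))).
  2: apply ex_series_Rabs_exp.
  intros k; change norm with Rabs; rewrite Rabs_Rabsolu.
  rewrite hypergeometric_term_repeat_1_2, Rabs_mult.
  rewrite <- (Rmult_1_l (Rabs (t ^ k / _))) at 2.
  apply Rmult_le_compat_r; [apply Rabs_pos|].
  assert (H1 : 1 <= (INR k + 1) ^ p)
    by (apply pow_R1_Rle; pose proof (pos_INR k); lra).
  rewrite Rabs_inv, Rabs_pos_eq by lra.
  apply Rinv_le_contravar in H1; [rewrite Rinv_1 in H1; exact H1 | lra].
Qed.

Lemma pow_opp_1_sub (n k : nat) :
  (k <= n)%nat -> (-1) ^ (n - k) = (-1) ^ n * (-1) ^ k.
Proof.
  (* Only the exponent on the right is split; the two factors [(-1) ^ k] then cancel. *)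
  intros Hk; replace n with ((n - k) + k)%nat at 2 by lia.
  rewrite pow_add, Rmult_assoc, <- Rpow_mult_distr.
  replace (-1 * -1) with 1 by ring; rewrite pow1; ring.
Qed.

Lemma gen_stirling2_cauchy_product (p n : nat) (t : R) :
  sum_f_R0 (fun k => hypergeometric_term (repeat 1 p) (repeat 2 p) t k *
                     ((- t) ^ (n - k) / INR (fact (n - k)))) n =
  gen_stirling2 p n * t ^ n.
Proof.
  unfold gen_stirling2.
  (* The factor [t ^ n * ((-1) ^ n / n!)] moves inside the sum, so that the two sides can be
     compared term by term. *)
  rewrite (Rmult_comm _ (t ^ n)), <- Rmult_assoc, scal_sum.
  apply sum_eq; intros k Hk.
  rewrite hypergeometric_term_repeat_1_2; unfold Binomial.C.
  replace (- t) with (-1 * t) by ring.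
  rewrite Rpow_mult_distr, pow_opp_1_sub by exact Hk.
  replace (t ^ n) with (t ^ k * t ^ (n - k)) by (rewrite <- pow_add; f_equal; lia).
  pose proof (pos_INR k).
  field; repeat split; try apply INR_fact_neq_0; apply pow_nonzero; lra.
Qed.

(** As [Series] is total, the first conjunct certifies that [hypergeometric] denotes a genuine sum
    here. *)
Theorem theorem1 (p : nat) (hp : (1 <= p)%nat) (t : R) :
  ex_series (hypergeometric_term (repeat 1 p) (repeat 2 p) t) /\
  is_series (fun n : nat => gen_stirling2 p n * t ^ n)
    (exp (- t) * hypergeometric (repeat 1 p) (repeat 2 p) t).
Proof.
  pose proof (ex_series_Rabs_hypergeometric_1_2 p t) as Habs.
  pose proof (ex_series_Rabs _ Habs) as Hex.
  split; [exact Hex|].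
  (* The hypergeometric factor comes first, as in [gen_stirling2_cauchy_product]. *)
  rewrite Rmult_comm.
  eapply is_series_ext; [intros n; apply gen_stirling2_cauchy_product|].
  apply (is_series_mult (hypergeometric_term (repeat 1 p) (repeat 2 p) t)
           (fun k => (- t) ^ k / INR (fact k))).
  - apply Series_correct; exact Hex.
  - apply is_series_exp.
  - exact Habs.
  - apply ex_series_Rabs_exp.
Qed.
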